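(* Let $F$ be a graph with at least one edge and without isolated vertices, with $v$ vertices and $\ell$ edges, and let $r\in\{0,1,\ldots,v-1\}$. Then the following three properties are equivalent: (1) For every integer $n\ge v$, $\mathrm{wsat}(n,F)\le g^*_r(n-v)+\ell-1$. (2) $\mathrm{wsat}(v,F)=\ell-1$, and the maximum element of $\mathcal{K}_r$ is at most $v-\beta$. (3) $\mathrm{wsat}(v,F)=\ell-1$, and, for every integer $i\ge 0$, $g^*_\beta(i)\le g^*_r(i)$.
   Context: All graphs are finite and simple. Given a graph $F$, an $F$-bootstrap percolation process is a sequence of graphs $H_0\subset H_1\subset\cdots\subset H_m$ on the same vertex set such that, for each $i=1,\ldots,m$, $H_i$ is obtained from $H_{i-1}$ by adding one edge that belongs to a copy of $F$ (a not necessarily induced subgraph isomorphic to $F$) in $H_i$. A graph $H$ on $[n]=\{1,\ldots,n\}$ is weakly $F$-saturated if there is an $F$-bootstrap percolation process $H=H_0\subset\cdots\subset H_m=K_n$. The number $\mathrm{wsat}(n,F)$ is the minimum number of edges of a weakly $F$-saturated graph on $[n]$. For a graph $F$ with $v$ vertices and $i\in[v]$, let $e_i=\min_{S\subset V(F),\,|S|=i}|E(F)\setminus E(F\setminus S)|-1$, where $F\setminus S$ is the subgraph of $F$ induced on $V(F)\setminus S$. For $r\in\{0,1,\ldots,v-1\}$ define $g^*_r(0)=0$ and, for $i\ge1$, $g^*_r(i)=\min(e_{i_1}+\cdots+e_{i_s})$, the minimum being over all $s\in[i]$ and all integers $1\le i_1,\ldots,i_s\le v-r$ with $i_1+\cdots+i_s=i$.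 Let $\mathcal{K}$ be the set of all $i\in[v]$ for which there are no positive integers $i_1,\ldots,i_s$ with $s\ge 2$, $i_1+\cdots+i_s=i$ and $e_i\ge e_{i_1}+\cdots+e_{i_s}$; put $\mathcal{K}_r=\mathcal{K}\cap[v-r]$. Let $\beta=\beta(F)$ be the minimum number of vertices that can be deleted from $F$ so that the remaining graph contains a cut-edge (an edge whose deletion increases the number of connected components). *)

(* Defs.v *)
From HB Require Import structures.
From mathcomp Require Import all_boot.

Set Implicit Arguments.
Unset Strict Implicit.
Unset Printing Implicit Defensive.

Record sgraph (T : finType) := SGraph {
  edges : {set {set T}};
  _ : [forall e in edges, #|e| == 2]
}.

HB.instance Definition _ (T : finType) := [isSub for @edges T].
HB.instance Definition _ (T : finType) := [Finite of sgraph T by <:].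

Fact complete_subproof (T : finType) :
  [forall e in [set e : {set T} | #|e| == 2], #|e| == 2].
Proof. by apply/forall_inP => e; rewrite inE. Qed.

Definition complete (T : finType) : sgraph T := SGraph (complete_subproof T).

(* The vertex set of F \ S is ~: S, and its edge set is [edges_del F S]. *)
Definition edges_del (V : finType) (F : sgraph V) (S : {set V}) :
  {set {set V}} := [set e in edges F | e \subset ~: S].

(* A copy of F in H is the image of F under an injection that sends edges of F
   to edges of H. *)
Definition in_copy (V T : finType) (F : sgraph V) (H : sgraph T) (f : {set T}) :
  bool :=
  [exists phi : {ffun V -> T},
    [&& injectiveb phi,
        [forall e in edges F, phi @: e \in edges H]
      & [exists e in edges F, f == phi @: e]]].

Definition bootstrap_step (V T : finType) (F : sgraph V) : rel (sgraph T) :=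
  fun H H' =>
  [exists f : {set T},
    [&& f \notin edges H, edges H' == f |: edges H & in_copy F H' f]].

Definition weakly_saturated (V T : finType) (F : sgraph V) (H : sgraph T) :
  bool := connect (bootstrap_step F) H (complete T).

(* \big[minn/x]_(i | P i) f i is the minimum of the f i when the range is
   nonempty and x is at least this minimum. The default values x below are
   chosen accordingly. *)

Definition wsat (n : nat) (V : finType) (F : sgraph V) : nat :=
  \big[minn/#|edges (complete 'I_n)|]_(H : sgraph 'I_n | weakly_saturated F H)
     #|edges H|.

(* If F has no isolated vertices and 1 <= i <= #|V|, the minimum is positive,
   so the predecessor is not truncated. *)
Definition e_ (V : finType) (F : sgraph V) (i : nat) : nat :=
  (\big[minn/#|edges F|]_(S : {set V} | #|S| == i)
     #|edges F :\: edges_del F S|).-1.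

(* For r < #|V| and i > 0, the index i * e_ 1 is the value of the admissible
   decomposition 1 + ... + 1 of i. *)
Definition gstar (V : finType) (F : sgraph V) (r i : nat) : nat :=
  if i == 0 then 0 else
  \big[minn/i * e_ F 1]_(1 <= s < i.+1)
    \big[minn/i * e_ F 1]_(t : s.-tuple 'I_(#|V| - r).+1
        | all (fun k : 'I__ => 0 < k) t && (\sum_(k <- t) k == i))
      \sum_(k <- t) e_ F k.

Definition inK (V : finType) (F : sgraph V) (i : nat) : Prop :=
  0 < i <= #|V| /\
  ~ exists t : seq nat,
      [/\ 2 <= size t, all (fun k => 0 < k) t, \sum_(k <- t) k = i
        & \sum_(k <- t) e_ F k <= e_ F i].

Definition inKr (V : finType) (F : sgraph V) (r i : nat) : Prop :=
  inK F i /\ 0 < i <= #|V| - r.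

Definition adj (V : finType) (E : {set {set V}}) : rel V :=
  fun x y => [set x; y] \in E.

(* For the graph with vertex set A and edge set E; all edges in E have to be
   subsets of A, since n_comp requires A to be closed under adjacency. *)
Definition components (V : finType) (A : {set V}) (E : {set {set V}}) : nat :=
  n_comp (adj E) A.

Definition cut_edge (V : finType) (A : {set V}) (E : {set {set V}})
  (e : {set V}) : bool :=
  (e \in E) && (components A E < components A (E :\ e)).

Definition beta (V : finType) (F : sgraph V) : nat :=
  \big[minn/#|V|]_(S : {set V}
      | [exists e, cut_edge (~: S) (edges_del F S) e])
    #|S|.

Definition is_maximum (P : nat -> Prop) (m : nat) : Prop :=
  P m /\ forall i, P i -> i <= m.

(* Main.v *)
(* P1 implies P2: explore the percolation process from a copy of F, adjoining
   one copy at a time to the explored set; a copy bringing i new vertices uses at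
   least e_i new edges of the initial graph. Take m maximal in K_r and
   n = v + m. As the bound allows only l - 1 + e_m edges and m is in K, the
   process must consist of two copies of F meeting in v - m vertices which
   contain all initial edges. The first edge between the two vertex sets then
   comes from a copy of F in which it is a cut edge once the common vertices are
   deleted, so beta <= v - m.

   P2 implies P3: parts of a decomposition can be refined into elements of K_r.

   P3 implies P1: a clique A on at least v vertices absorbs i <= v - beta further
   vertices at the cost of e_i edges. These edges and A yield a copy of F, hence a
   clique W on the new vertices and v - i >= beta vertices of A; a cut edge of F
   after deletion of beta vertices produces all edges between A and W. *)

Require Import Defs.
From mathcomp Require Import all_boot.
From Stdlib Require Import Classical.

Set Implicit Arguments.
Unset Strict Implicit.
Unset Printing Implicit Defensive.

(** * Minima over lists, and graphs given by their edge sets *)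

Lemma bigmin_le (I : eqType) (s : seq I) (P : pred I) (f : I -> nat) x i :
  i \in s -> P i -> \big[minn/x]_(j <- s | P j) f j <= f i.
Proof.
elim: s => // j s IHs; rewrite inE big_cons => /orP[/eqP -> Pj | si Pi].
  by rewrite Pj geq_minl.
by case: ifP => _; [rewrite geq_min (IHs si Pi) orbT | apply: IHs].
Qed.

(** The default [x] may undercut every [f i], so it is a separate outcome, which each use treats on
    its own. *)
Lemma bigmin_attained (I : eqType) (s : seq I) (P : pred I) (f : I -> nat) x :
  \big[minn/x]_(j <- s | P j) f j = x \/
  exists2 i, (i \in s) && P i & \big[minn/x]_(j <- s | P j) f j = f i.
Proof.
elim: s => [|j s IHs]; first by left; rewrite big_nil.
rewrite big_cons; case: (boolP (P j)) => Pj; last first.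
  case: IHs => [|[i /andP[si Pi] ->]]; [by left | right].
  by exists i; rewrite // inE si orbT.
have [le_j | /ltnW le_s] := leqP (f j) (\big[minn/x]_(k <- s | P k) f k).
  by right; exists j => //; rewrite mem_head.
case: IHs => [|[i /andP[si Pi] eq_i]]; first by left.
by right; exists i; rewrite // inE si orbT.
Qed.

Lemma edge_card (T : finType) (H : sgraph T) f : f \in edges H -> #|f| = 2.
Proof. by case: H => E EP /= /(forall_inP EP)/eqP. Qed.

Definition clique (T : finType) (A : {set T}) : {set {set T}} :=
  [set f : {set T} | (#|f| == 2) && (f \subset A)].

Lemma edges_sub_clique (T : finType) (H : sgraph T) : edges H \subset clique setT.
Proof. by apply/subsetP => f /edge_card; rewrite inE subsetT => ->. Qed.

Lemma edges_complete (T : finType) : edges (complete T) = clique setT.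
Proof. by apply/setP => f; rewrite !inE subsetT andbT. Qed.

Lemma graph_of_clique (T : finType) (E : {set {set T}}) :
  E \subset clique setT -> exists H : sgraph T, edges H = E.
Proof.
move=> sE.
have EP : [forall e in E, #|e| == 2].
  by apply/forall_inP => e /(subsetP sE); rewrite inE => /andP[].
by exists (SGraph EP).
Qed.

(** * Extension of injections *)

(** The cardinality hypothesis leaves at least [#|Y|] elements of [C] outside [f @: X]; the elements
    of [Y] are sent to these in order of enumeration. *)
Lemma extend_inj (V T : finType) (f : V -> T) (X Y : {set V}) (C : {set T}) :
  {in X &, injective f} -> [disjoint X & Y] ->
  #|Y| + #|f @: X :&: C| <= #|C| ->
  exists g : V -> T,
    [/\ {in X, g =1 f}, {in X :|: Y &, injective g} & g @: Y \subset C].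
Proof.
move=> inj_f dXY leC.
pose s := enum (C :\: f @: X).
have le_s : #|Y| <= size s.
  by rewrite -cardE cardsD setIC leq_subRL ?(leq_trans _ leC) ?leq_addl // addnC.
pose g y := if y \in X then f y else nth (f y) s (index y (enum Y)).
have YnX y : y \in Y -> (y \in X) = false.
  by move=> Yy; apply: contraTF Yy => Xy; rewrite (disjointFr dXY).
have lt_s y : y \in Y -> index y (enum Y) < size s.
  by move=> Yy; rewrite (leq_trans _ le_s) // cardE index_mem mem_enum.
have gY y : y \in Y -> g y \in C :\: f @: X.
  by move=> Yy; rewrite -mem_enum /g YnX // mem_nth ?lt_s.
have gX : {in X, g =1 f} by move=> x Xx; rewrite /g Xx.
exists g; split=> //; last first.
  by apply/subsetP => _ /imsetP[y /gY gy ->]; case/setDP: gy.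
have sep x y : x \in X -> y \in Y -> g x <> g y.
  move=> Xx /gY /setDP[_ gy] gxy; case/negP: gy.
  by rewrite -gxy gX ?imset_f.
move=> x y /setUP[Xx|Yx] /setUP[Xy|Yy] gxy.
- by apply: inj_f => //; rewrite -!gX.
- by case: (sep x y).
- by case: (sep y x).
have : nth (f x) s (index x (enum Y)) == nth (f x) s (index y (enum Y)).
  apply/eqP; move: gxy; rewrite /g !YnX // => ->.
  by apply: set_nth_default; rewrite lt_s.
rewrite nth_uniq ?lt_s ?enum_uniq // => /eqP idx.
by rewrite -(nth_index x (s := enum Y) (x := x)) ?idx ?nth_index ?mem_enum.
Qed.

Lemma extend_inj_room (V T : finType) (f : V -> T) (X Y : {set V}) (C : {set T}) :
  {in X &, injective f} -> [disjoint X & Y] -> #|V| <= #|C| ->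
  exists g : V -> T,
    [/\ {in X, g =1 f}, {in X :|: Y &, injective g} & g @: Y \subset C].
Proof.
move=> inj_f dXY leC; apply: extend_inj => //; apply: leq_trans leC.
apply: leq_trans (leq_add (leqnn _) (subset_leq_card (subsetIl _ _))) _.
rewrite card_in_imset // addnC; move: (leq_card_setU X Y); rewrite dXY => /leqifP/eqP <-.
exact: max_card.
Qed.

Lemma embed_split (V T : finType) (t0 : T) (S : {set V}) (A B : {set T}) :
  [disjoint A & B] -> #|S| <= #|B| -> #|~: S| <= #|A| ->
  exists f : V -> T,
    [/\ injective f, f @: S \subset B & f @: (~: S) \subset A].
Proof.
move=> dAB leB leA.
have [|||f [_ inj_f fS]] := @extend_inj V T (fun=> t0) set0 S B.
- by move=> x y; rewrite inE.
- by rewrite -setI_eq0 set0I.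
- by rewrite imset0 set0I cards0 addn0.
have [|||g [gf inj_g gS]] := @extend_inj V T f S (~: S) A.
- by move=> x y Sx Sy; apply: inj_f; rewrite inE ?Sx ?Sy orbT.
- by rewrite disjoints_subset setCK.
- rewrite (_ : _ :&: _ = set0) ?cards0 ?addn0 //; apply/eqP.
  by rewrite setI_eq0; apply: (disjointWl fS); rewrite disjoint_sym.
exists g; split=> //.
- by move=> x y; apply: inj_g; rewrite setUCr inE.
- by rewrite (eq_in_imset gf).
Qed.

(** * Percolation as an inductive derivation *)

(** The percolation closure of [E], freed from the order of the steps: an edge is produced once all
    other edges of some copy of [F] through it are available. *)
Inductive derived (V T : finType) (F : sgraph V) (E : {set {set T}}) :
  {set T} -> Prop :=
| derived_base f : f \in E -> derived F E f
| derived_copy (phi : V -> T) e0 :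
    injective phi -> e0 \in edges F ->
    (forall e, e \in edges F -> e != e0 -> derived F E (phi @: e)) ->
    derived F E (phi @: e0).

Section Derived.

Context (V T : finType) (F : sgraph V).

Lemma derived_trans (E E' : {set {set T}}) f :
  (forall g, g \in E -> derived F E' g) -> derived F E f -> derived F E' f.
Proof.
move=> sub; elim=> {f} [f /sub // | phi e0 inj_phi Fe0 _ IH].
exact: derived_copy.
Qed.

Lemma derived_imset (T' : finType) (psi : T -> T') (E : {set {set T}}) f :
  injective psi -> derived F E f ->
  derived F [set psi @: (g : {set T}) | g in E] (psi @: f).
Proof.
move=> inj_psi; elim=> {f} [f Ef | phi e0 inj_phi Fe0 _ IH].
  by apply: derived_base; rewrite imset_f.
rewrite -imset_comp; apply: derived_copy => //; first exact: inj_comp.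
by move=> e Fe ne; rewrite imset_comp; apply: IH.
Qed.

Definition almost_copy (E : {set {set T}}) (phi : V -> T) (e0 : {set V}) :=
  [/\ injective phi, e0 \in edges F &
      forall e, e \in edges F -> e != e0 -> phi @: e \in E].

(** Edges of [E] lie in [P], so descending in the derivation of [f] through premises outside [P]
    must stop at a copy whose other edges all lie in [P]. *)
Lemma derived_escape (E P : {set {set T}}) f :
  E \subset P -> derived F E f -> f \notin P ->
  exists phi e0, almost_copy P phi e0 /\ phi @: e0 \notin P.
Proof.
move=> sEP; elim=> {f} [f /(subsetP sEP) -> // | phi e0 inj_phi Fe0 _ IH] e0P.
have [/forall_inP all_in | /forall_inPn[e Fe]] :=
  boolP [forall e in edges F, (e != e0) ==> (phi @: e \in P)].
  by exists phi, e0; do 2!split=> //; move=> e Fe ne; apply: (implyP (all_in e Fe)).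
by rewrite negb_imply => /andP[ne eP]; apply: IH eP.
Qed.

Lemma bootstrap_derived (H G : sgraph T) f :
  connect (bootstrap_step F) H G -> f \in edges G -> derived F (edges H) f.
Proof.
case/connectP=> p; elim: p H => [|H1 p IHp] H /=.
  by move=> _ -> Hf; apply: derived_base.
case/andP=> /existsP[g /and3P[gH /eqP H1E]] cpy pth eG Gf.
apply: derived_trans (IHp _ pth eG Gf) => h; rewrite H1E => /setU1P[->|]; last first.
  exact: derived_base.
case/existsP: cpy => phi /and3P[/injectiveP inj_phi /forall_inP copyP].
case/existsP=> e0 /andP[Fe0 /eqP gE0]; rewrite gE0.
apply: derived_copy => // e Fe ne; apply: derived_base.
have := copyP e Fe; rewrite H1E gE0 => /setU1P[/(imset_inj inj_phi) ee0|//].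
by rewrite ee0 eqxx in ne.
Qed.

(** For the converse, a reachable graph with the most edges contains every derived edge, as
    otherwise one more step would enlarge it. *)
Lemma weakly_saturatedP (H : sgraph T) :
  weakly_saturated F H <-> forall f, f \in clique setT -> derived F (edges H) f.
Proof.
split=> [wsH f|allD].
  by rewrite -edges_complete; apply: bootstrap_derived.
pose reach := connect (@bootstrap_step V T F) H.
have [G reachG maxG] := arg_maxnP (fun G : sgraph T => #|edges G|) (connect0 _ H : reach H).
suff GE : edges G = edges (complete T) by rewrite /weakly_saturated -(val_inj GE).
apply/eqP; rewrite eqEsubset edges_complete edges_sub_clique /=.
apply/subsetP => f /allD; elim=> {f} [f Hf | phi e0 inj_phi Fe0 _ IH].
  case/connectP: (reachG) => p; elim: p (H) Hf => [|H1 p IHp] K Kf /=.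
    by move=> _ ->.
  case/andP=> /existsP[g /and3P[_ /eqP H1E _]]; apply: IHp.
  by rewrite H1E inE Kf orbT.
apply: contraT => nG.
have sub : phi @: e0 |: edges G \subset clique setT.
  rewrite subUset edges_sub_clique andbT sub1set inE subsetT andbT.
  by rewrite card_imset // (edge_card Fe0).
have [G' G'E] := graph_of_clique sub.
have : reach G'.
  apply: connect_trans reachG (connect1 _).
  apply/existsP; exists (phi @: e0); rewrite nG G'E eqxx /=.
  apply/existsP; exists (finfun phi).
  have fE (e : {set V}) : finfun phi @: e = phi @: e.
    by apply: eq_imset => x; rewrite ffunE.
  apply/and3P; split.
  - by apply/injectiveP => x y; rewrite !ffunE; apply: inj_phi.
  - apply/forall_inP => e Fe; rewrite fE G'E inE.
    by have [->|ne] := eqVneq e e0; [rewrite set11 | rewrite IH // orbT].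
  - by apply/existsP; exists e0; rewrite Fe0 fE /=.
by move=> /maxG /=; rewrite G'E cardsU1 nG add1n ltnn.
Qed.

Lemma wsat_attained n :
  exists H : sgraph 'I_n, weakly_saturated F H /\ wsat n F = #|edges H|.
Proof.
rewrite /wsat.
have [->|[H /andP[_ wsH] ->]] := bigmin_attained (index_enum (sgraph 'I_n))
  (weakly_saturated F) (fun H => #|edges H|) #|edges (complete 'I_n)|.
  by exists (complete 'I_n); split=> //; apply: connect0.
by exists H.
Qed.

Lemma wsat_le n (H : sgraph 'I_n) : weakly_saturated F H -> wsat n F <= #|edges H|.
Proof. by apply: bigmin_le; rewrite mem_index_enum. Qed.

End Derived.

(** * Cut edges, bipartitions and the number beta *)

Lemma adj_sym (V : finType) (E : {set {set V}}) : symmetric (adj E).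
Proof. by move=> x y; rewrite /adj setUC. Qed.

Lemma adj_closed (V : finType) (A : {set V}) (E : {set {set V}}) :
  E \subset clique A -> closed (adj E) A.
Proof.
move=> sE x y /(subsetP sE); rewrite inE subUset !sub1set => /and3P[_ -> ->] //.
Qed.

Definition crosses (V : finType) (X e : {set V}) :=
  ~~ (e \subset X) && ~~ (e \subset ~: X).

Lemma crosses_pair (V : finType) (X : {set V}) x y :
  x \in X -> y \notin X -> crosses X [set x; y].
Proof.
by move=> Xx Xy; rewrite /crosses !subUset !sub1set !inE Xx (negbTE Xy).
Qed.

Lemma pair_of_crossing (V : finType) (X e : {set V}) :
  #|e| = 2 -> crosses X e -> exists x y, [/\ e = [set x; y], x \in X & y \notin X].
Proof.
move=> /eqP/cards2P[x [y [_ ->]]].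
rewrite /crosses !subUset !sub1set !inE.
case Xx: (x \in X); case Xy: (y \in X) => //= _; first by exists x, y; rewrite Xy.
by exists y, x; rewrite setUC Xy Xx.
Qed.

Lemma cut_edge_bipartition (V : finType) (A : {set V}) (E : {set {set V}}) e :
  E \subset clique A -> cut_edge A E e ->
  exists X : {set V}, crosses X e /\
    forall e', e' \in E -> e' != e -> ~~ crosses X e'.
Proof.
move=> sE /andP[Ee]; rewrite /components => lt_comp.
have /setIdP[/cards2P[x [y [nxy eE]]] _] := subsetP sE e Ee.
pose E' := E :\ e.
have symE' := sym_connect_sym (@adj_sym V E').
(* If [y] were still reachable from [x], deleting [e] would change neither connectivity nor the
   number of components. *)
have nconn : ~~ connect (adj E') x y.
  apply: contraL lt_comp => xy; rewrite -leqNgt.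
  rewrite (@eq_n_comp _ (adj E) (adj E')) // => u w.
  apply/idP/idP; apply: connect_sub => {}u {}w uw; last first.
    by apply: connect1; move: uw; rewrite /adj => /setD1P[].
  have [uwe|uwe] := eqVneq [set u; w] e; last first.
    by apply: connect1; rewrite /adj in_setD1 uwe.
  have : u \in e /\ w \in e by rewrite -uwe !inE !eqxx orbT.
  rewrite eE !inE => -[/orP[]/eqP-> /orP[]/eqP->] //.
  by rewrite symE'.
(* The component of [x] after deletion of [e] is a side that no edge but [e] leaves. *)
exists [set z | connect (adj E') x z]; split.
  by rewrite eE; apply: crosses_pair; rewrite inE ?connect0.
move=> e' Ee' ne'.
have /setIdP[/cards2P[u [w [_ e'E]]] _] := subsetP sE e' Ee'.
have uw : adj E' u w by rewrite /adj in_setD1 -e'E ne'.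
rewrite /crosses e'E !subUset !sub1set !inE.
by rewrite (same_connect1r symE' uw); case: connect.
Qed.

(* Roots of the components of E minus e map onto the roots for E, and the two
   ends of e are in different components of E minus e but the same one for E. *)
Lemma bipartition_cut_edge (V : finType) (A : {set V}) (E : {set {set V}}) e
    (X : {set V}) :
  E \subset clique A -> e \in E -> crosses X e ->
  (forall e', e' \in E -> e' != e -> ~~ crosses X e') -> cut_edge A E e.
Proof.
move=> sE Ee crX ncr; rewrite /cut_edge Ee /components /n_comp_mem /=.
have /setIdP[/eqP card_e eA] := subsetP sE e Ee.
have [x [y [eE Xx Xy]]] := pair_of_crossing card_e crX.
pose E' := E :\ e.
have sE' : E' \subset clique A by rewrite (subset_trans _ sE) ?subD1set.
have symE := sym_connect_sym (@adj_sym V E).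
have symE' := sym_connect_sym (@adj_sym V E').
have clX : closed (adj E') X.
  move=> u w /setD1P[ne Euw]; move: (ncr _ Euw ne).
  rewrite /crosses !subUset !sub1set !inE.
  by case: (u \in X); case: (w \in X).
have nconn : ~~ connect (adj E') x y.
  by apply: contra Xy => /(closed_connect clX) <-.
have sub_conn u w : connect (adj E') u w -> connect (adj E) u w.
  apply: connect_sub => {}u {}w uw; apply: connect1.
  by move: uw; rewrite /adj => /setD1P[].
have Axy : (x \in A) && (y \in A) by move: eA; rewrite eE subUset !sub1set.
case/andP: Axy => Ax Ay.
pose R' := [set z in A | fingraph.roots (adj E') z].
pose R := [set z in A | fingraph.roots (adj E) z].
have -> : #|predI (fingraph.roots (adj E)) (mem A)| = #|R|.
  by apply: eq_card => z; rewrite !inE andbC.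
have -> : #|predI (fingraph.roots (adj E')) (mem A)| = #|R'|.
  by apply: eq_card => z; rewrite !inE andbC.
have rootA z : z \in A -> fingraph.root (adj E') z \in R'.
  move=> Az; rewrite inE roots_root // andbT.
  by rewrite -(closed_connect (adj_closed sE') (connect_root _ z)).
set ry := fingraph.root (adj E') y; set rx := fingraph.root (adj E') x.
have nr : rx != ry by rewrite root_connect.
rewrite (cardsD1 ry R') rootA // add1n ltnS.
suff sub : R \subset fingraph.root (adj E) @: (R' :\ ry).
  exact: leq_trans (subset_leq_card sub) (leq_imset_card _ _).
apply/subsetP => z /setIdP[Az /eqP rz].
have rE w : fingraph.root (adj E) (fingraph.root (adj E') w) = fingraph.root (adj E) w.
  by apply/esym/rootP => //; apply/sub_conn/connect_root.
have [zy|zy] := eqVneq (fingraph.root (adj E') z) ry; last first.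
  apply/imsetP; exists (fingraph.root (adj E') z); last by rewrite rE.
  by rewrite in_setD1 zy rootA.
apply/imsetP; exists rx; first by rewrite in_setD1 nr rootA.
rewrite rE -{1}rz -(rE z) zy rE.
by apply/rootP => //; rewrite symE; apply: connect1; rewrite /adj -eE.
Qed.

Lemma edges_del_clique (V : finType) (F : sgraph V) S :
  edges_del F S \subset clique (~: S).
Proof.
by apply/subsetP => e /setIdP[/edge_card e2 eS]; rewrite inE e2 eS.
Qed.

Lemma beta_le (V : finType) (F : sgraph V) (D X e0 : {set V}) :
  e0 \in edges_del F D -> crosses X e0 ->
  (forall e, e \in edges_del F D -> e != e0 -> ~~ crosses X e) ->
  beta F <= #|D|.
Proof.
move=> Fe0 cr0 ncr; apply: bigmin_le; first by rewrite mem_index_enum.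
apply/existsP; exists e0.
exact: bipartition_cut_edge (edges_del_clique F D) Fe0 cr0 ncr.
Qed.

(** After deletion of all vertices except the two ends of [e0], the only edge left is [e0], which is
    a cut edge. *)
Lemma beta_edge_bound (V : finType) (F : sgraph V) e0 :
  e0 \in edges F -> beta F + 2 <= #|V|.
Proof.
move=> Fe0; have e2 := edge_card Fe0.
have /cards2P[x [y [nxy eE]]] : #|e0| == 2 by rewrite e2.
suff le : beta F <= #|~: e0|.
  by rewrite -(cardsC e0) e2 addnC leq_add2l.
apply: (@beta_le _ _ _ [set x] e0).
- by rewrite inE Fe0 setCK /=.
- by rewrite eE; apply: crosses_pair; rewrite ?set11 // inE eq_sym.
- move=> e /setIdP[Fe]; rewrite setCK => se; case/eqP.
  by apply/eqP; rewrite eqEcard se e2 (edge_card Fe).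
Qed.

Lemma beta_attained (V : finType) (F : sgraph V) e :
  e \in edges F ->
  exists (D X : {set V}) x y,
    [/\ #|D| = beta F, [set x; y] \in edges_del F D, x \in X, y \notin X &
        forall e', e' \in edges F -> e' != [set x; y] ->
          (e' \subset D :|: X) || (e' \subset D :|: ~: X)].
Proof.
move=> Fe; rewrite /beta.
have := beta_edge_bound Fe; rewrite /beta.
(* The default [#|V|] of the minimum is excluded by [beta_edge_bound]. *)
have [->|[D /andP[_ /existsP[e0 cut0]] ->] _] := bigmin_attained (index_enum {set V})
  (fun S => [exists e, cut_edge (~: S) (edges_del F S) e]) (fun S => #|S|) #|V|.
  by rewrite addn2 ltnNge leqnSn.
have [X [cr0 ncr]] := cut_edge_bipartition (edges_del_clique F D) cut0.
case/andP: cut0 => Fe0 _.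
have /setIdP[/eqP e2 e0D] := subsetP (edges_del_clique F D) e0 Fe0.
have [x [y [eE Xx Xy]]] := pair_of_crossing e2 cr0.
exists D, X, x, y; rewrite -eE; split=> // e' Fe' ne'.
have [e'D|] := boolP (e' \subset ~: D).
  have: e' \in edges_del F D by rewrite inE Fe' e'D.
  move/ncr=> /(_ ne'); rewrite /crosses negb_and !negbK.
  by case/orP=> sX; rewrite (subset_trans sX (subsetUr _ _)) ?orbT.
(* An edge with one end in [D] fits into [D] together with whichever side holds its other end. *)
case/subsetPn=> z ze'; rewrite inE negbK => Dz.
have /eqP/cards2P[u [w [_ e'E]]] := edge_card Fe'.
rewrite {1 2}e'E !subUset !sub1set !inE.
move: ze'; rewrite e'E !inE => /orP[]/eqP zE; rewrite -zE Dz /= ?andbT -?orb_andl.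
  by case: (w \in D) (w \in X) => [] [].
by case: (u \in D) (u \in X) => [] [].
Qed.

(** * The numbers e_i and the function g* *)

Definition touching (V : finType) (F : sgraph V) (S : {set V}) :=
  edges F :\: edges_del F S.

Lemma touchingE (V : finType) (F : sgraph V) S e :
  (e \in touching F S) = (e \in edges F) && ~~ (e \subset ~: S).
Proof. by rewrite !inE; case: (e \in edges F); rewrite ?andbF ?andbT. Qed.

Lemma e_le (V : finType) (F : sgraph V) (S : {set V}) : e_ F #|S| <= #|touching F S|.-1.
Proof.
rewrite /e_ -!subn1; apply: leq_sub2r.
by apply: (bigmin_le _ _ (i := S)); rewrite ?mem_index_enum.
Qed.

Lemma e_attained (V : finType) (F : sgraph V) i :
  i <= #|V| -> exists2 S : {set V}, #|S| = i & e_ F i = #|touching F S|.-1.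
Proof.
move=> le_i; rewrite /e_; have [minE|[S /andP[_ /eqP Si] ->]] := bigmin_attained
  (index_enum {set V}) (fun S => #|S| == i) (fun S => #|touching F S|) #|edges F|;
  last by exists S.
(* If the minimum equals its default [#|edges F|], every set of size [i] is touched by all edges of
   [F], so any such set attains it. *)
have [S Si] : exists S : {set V}, #|S| == i.
  have : 0 < #|[set S : {set V} | #|S| == i]| by rewrite card_draws bin_gt0.
  by case/card_gt0P=> S; rewrite inE; exists S.
exists S; first exact/eqP.
congr _.-1; rewrite minE; apply/esym/eqP; rewrite eqn_leq subset_leq_card ?subsetDl ?andbT //.
by rewrite -{1}minE; apply: (bigmin_le _ _ (i := S)); rewrite ?mem_index_enum.
Qed.

Lemma size_le_sum (t : seq nat) : all (fun k => 0 < k) t -> size t <= \sum_(k <- t) k.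
Proof.
elim: t => //= k t IHt /andP[k0 /IHt le]; rewrite big_cons.
by rewrite -add1n leq_add.
Qed.

Lemma gstar_le (V : finType) (F : sgraph V) r (t : seq nat) :
  all (fun k => 0 < k <= #|V| - r) t ->
  gstar F r (\sum_(k <- t) k) <= \sum_(k <- t) e_ F k.
Proof.
move=> tP; rewrite /gstar; case: ifP => // /negbT sum0.
have t_gt0 : all (fun k => 0 < k) t by apply: sub_all tP => k /andP[].
have [u tE] : exists u : seq 'I_(#|V| - r).+1, t = map val u.
  exists (map (@inord (#|V| - r)) t).
  rewrite -map_comp; apply/esym/map_id_in => k /(allP tP)/andP[_ le_k] /=.
  by rewrite inordK.
subst t; rewrite !big_map in sum0 *.
have := size_le_sum t_gt0; rewrite size_map big_map => le_size.
apply: leq_trans (bigmin_le _ _ (i := size u) _ _) _ => //.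
  rewrite mem_index_iota ltnS le_size andbT lt0n.
  by apply: contra sum0; rewrite size_eq0 => /eqP->; rewrite big_nil.
apply: leq_trans (bigmin_le _ _ (i := in_tuple u) _ _) _ => //.
  by rewrite mem_index_enum.
by rewrite eqxx andbT; move: t_gt0; rewrite all_map.
Qed.

Lemma gstar_attained (V : finType) (F : sgraph V) r i :
  r < #|V| -> exists t : seq nat,
    [/\ all (fun k => 0 < k <= #|V| - r) t, \sum_(k <- t) k = i &
        gstar F r i = \sum_(k <- t) e_ F k].
Proof.
move=> r_lt; rewrite /gstar; case: eqP => [->|_].
  by exists [::]; rewrite !big_nil.
(* The default value of both minima is the cost of the all-ones decomposition, which is admissible
   because [r < #|V|]. *)
have default : exists t : seq nat,
    [/\ all (fun k => 0 < k <= #|V| - r) t, \sum_(k <- t) k = i &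
        i * e_ F 1 = \sum_(k <- t) e_ F k].
  exists (nseq i 1); rewrite all_nseq /= subn_gt0 r_lt orbT.
  by rewrite !big_nseq !iter_addn !addn0 mul1n mulnC.
elim/big_ind: _ => // [x y Qx Qy | s _]; first by rewrite /minn; case: ifP.
elim/big_ind: _ => // [x y Qx Qy | t /andP[t0 /eqP tE]].
  by rewrite /minn; case: ifP.
exists (map val t); rewrite !big_map; split=> //.
by rewrite all_map; apply: sub_all t0 => k /= ->; rewrite -ltnS ltn_ord.
Qed.

Lemma touching_gt0 (V : finType) (F : sgraph V) (S : {set V}) :
  (forall x : V, exists2 e : {set V}, e \in edges F & x \in e) ->
  0 < #|S| -> 0 < #|touching F S|.
Proof.
move=> no_iso /card_gt0P[x Sx]; have [e Fe xe] := no_iso x.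
apply/card_gt0P; exists e; rewrite touchingE Fe /=.
by apply/subsetPn; exists x; rewrite // inE Sx.
Qed.

(** * Generating cliques from few edges *)

(** The pair [f] is pulled back along [psi], derived from [F] on its own vertex set, and this
    derivation is transported by [psi]. *)
Lemma derived_in_copy (V T : finType) (F : sgraph V) (psi : V -> T)
    (E : {set {set T}}) f :
  (forall g, g \in clique setT -> derived F (edges F) g) -> injective psi ->
  (forall e, e \in edges F -> derived F E (psi @: e)) ->
  f \in clique (psi @: setT) -> derived F E f.
Proof.
move=> Fsat inj_psi FE /setIdP[f2 sf].
have fE : psi @: (psi @^-1: f) = f.
  apply/setP => z; apply/imsetP/idP => [[x]|fz]; first by rewrite inE => ? ->.
  by have /imsetP[x _ zx] := subsetP sf z fz; exists x; rewrite ?inE -?zx.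
apply: (@derived_trans _ _ _ [set psi @: (e : {set V}) | e in edges F]).
  by move=> _ /imsetP[e Fe ->]; apply: FE.
rewrite -fE; apply: derived_imset => //; apply: Fsat.
by rewrite inE subsetT andbT -(card_imset _ inj_psi) fE.
Qed.

(* Two cliques on at least #|V| vertices sharing beta F vertices merge: map the
   two sides of a cut edge of F minus D into the two cliques, and D into their
   intersection; only the image of the cut edge can be missing. *)
Lemma derived_cross (V T : finType) (F : sgraph V) (A W : {set T})
    (E : {set {set T}}) a b :
  (exists e, e \in edges F) -> #|V| <= #|A| -> #|V| <= #|W| ->
  beta F <= #|A :&: W| -> a \in A :\: W -> b \in W :\: A ->
  (forall f, f \in clique A -> derived F E f) ->
  (forall f, f \in clique W -> derived F E f) ->
  derived F E [set a; b].
Proof.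
move=> [e Fe] leA leW leAW /setDP[Aa Wa] /setDP[Wb Ab] dA dW.
have [D [X [x [y [cardD /setIdP[Fxy sD] Xx nXy side]]]]] := beta_attained Fe.
have [Dx Dy] : x \notin D /\ y \notin D.
  by move: sD; rewrite subUset !sub1set !inE => /andP[].
have nxy : x != y by apply: contraNneq nXy => <-.
have nba : b != a by apply: contraNneq Wa => <-.
(* The cut edge is to be mapped onto the missing pair: its end [x] in [X] goes to [W], its end [y]
   outside [X] goes to [A]. *)
pose f0 z := if z == x then b else a.
have f0x : f0 x = b by rewrite /f0 eqxx.
have f0y : f0 y = a by rewrite /f0 eq_sym (negbTE nxy).
have f0xy : f0 @: [set x; y] = [set b; a] by rewrite imsetU1 imset_set1 f0x f0y.
have [|||f1 [f1E inj1 f1D]] := @extend_inj V T f0 [set x; y] D (A :&: W).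
- move=> u w; rewrite !inE => /orP[]/eqP-> /orP[]/eqP->; rewrite ?f0x ?f0y // => /eqP.
    by rewrite (negbTE nba).
  by rewrite eq_sym (negbTE nba).
- by rewrite disjoints_subset.
- rewrite f0xy cardD (_ : _ :&: _ = set0) ?cards0 ?addn0 //.
  apply/setP => z; rewrite !inE; apply/negP => /andP[/orP[]/eqP-> /andP[]].
    by rewrite (negbTE Ab).
  by move=> _; rewrite (negbTE Wa).
pose Z := [set x; y] :|: D.
(* The rest of [X] is sent into [W], and then all remaining vertices into [A]; both cliques have
   room for all of [V]. *)
have [|f2 [f2E inj2 f2X]] := extend_inj_room (Y := X :\: Z) inj1 _ leW.
  by rewrite disjoint_sym disjoints_subset setDE subsetIr.
have [|f3 [f3E inj3 f3Y]] := extend_inj_room (Y := ~: (Z :|: X :\: Z)) inj2 _ leA.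
  by rewrite disjoints_subset setCK.
have {}inj3 : injective f3 by move=> u w; apply: inj3; rewrite setUCr inE.
have f3xy z : z \in [set x; y] -> f3 z = f0 z.
  move=> xyz; have Zz : z \in Z by apply/setUP; left.
  by rewrite f3E ?f2E ?f1E //; apply/setUP; left.
have f3x : f3 x = b by rewrite f3xy ?set21.
have f3y : f3 y = a by rewrite f3xy ?set22.
have f3D z : z \in D -> f3 z \in A :&: W.
  move=> Dz; rewrite f3E ?f2E ?in_setU ?Dz ?orbT //.
  by apply: (subsetP f1D); rewrite imset_f.
have f3W z : z \in D :|: X -> f3 z \in W.
  case/setUP=> [/f3D/setIP[]//|Xz].
  have [/setUP[/set2P[zx|zy]|/f3D/setIP[]//]|Zz] := boolP (z \in Z).
  - by rewrite zx f3x.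
  - by rewrite -zy Xz in nXy.
  have XZz : z \in X :\: Z by rewrite inE Zz.
  by rewrite f3E ?(in_setU z) ?XZz ?orbT //; apply: (subsetP f2X); rewrite imset_f.
have f3A z : z \in D :|: ~: X -> f3 z \in A.
  case/setUP=> [/f3D/setIP[]//|]; rewrite inE => Xz.
  have [/setUP[/set2P[zx|zy]|/f3D/setIP[]//]|Zz] := boolP (z \in Z).
  - by rewrite zx Xx in Xz.
  - by rewrite zy f3y.
  apply: (subsetP f3Y); rewrite imset_f //.
  by rewrite in_setC in_setU in_setD negb_or Zz (negbTE Xz) andbF.
have -> : [set a; b] = f3 @: [set x; y].
  by rewrite imsetU1 imset_set1 f3x f3y setUC.
apply: derived_copy => // e' Fe' ne'.
have e'2 : #|f3 @: e'| == 2 by rewrite card_imset // (edge_card Fe').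
case/orP: (side e' Fe' ne') => /subsetP sub; [apply: dW | apply: dA].
  by rewrite inE e'2; apply/subsetP => _ /imsetP[z /sub/f3W ? ->].
by rewrite inE e'2; apply/subsetP => _ /imsetP[z /sub/f3A ? ->].
Qed.

(** A set attaining the minimum in [e_] is placed on [B] and the other vertices of [F] in [A]. The
    added edges complete a copy of [F] on a set [W] containing [B]; self-saturation makes [W] a
    clique, which then merges with [A]. *)
Lemma extend_clique (V T : finType) (F : sgraph V) (A B : {set T}) :
  (forall x : V, exists2 e : {set V}, e \in edges F & x \in e) ->
  (forall g, g \in clique setT -> derived F (edges F) g) ->
  #|V| <= #|A| -> [disjoint A & B] -> 0 < #|B| <= #|V| - beta F ->
  exists E : {set {set T}},
    [/\ E \subset clique setT, #|E| <= e_ F #|B| &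
        forall f, f \in clique (A :|: B) -> derived F (clique A :|: E) f].
Proof.
move=> no_iso Fsat leA dAB /andP[B0 leB].
have leBV : #|B| <= #|V| := leq_trans leB (leq_subr _ _).
have [S cardS ->] := e_attained F leBV.
have [b _] := card_gt0P B0.
have [|||psi [inj_psi psiS psiA]] := @embed_split V T b S A B => //.
- by rewrite cardS.
- by apply: leq_trans leA; apply: max_card.
have /card_gt0P[e0 te0] : 0 < #|touching F S| by rewrite touching_gt0 ?cardS.
have Fe0 : e0 \in edges F by move: te0; rewrite touchingE => /andP[].
(* The edge [e0] is omitted because the copy itself supplies it; this is the subtracted 1 in the
   definition of [e_]. *)
pose E := [set psi @: (e : {set V}) | e in touching F S :\ e0].
have card_psi e : e \in edges F -> #|psi @: e| == 2.
  by move=> Fe; rewrite card_imset // (edge_card Fe).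
exists E; split.
- apply/subsetP => _ /imsetP[e /setD1P[_ te] ->].
  by move: te; rewrite touchingE inE subsetT andbT => /andP[/card_psi].
- by rewrite (cardsD1 e0 (touching F S)) te0 leq_imset_card.
have dA f : f \in clique A -> derived F (clique A :|: E) f.
  by move=> Af; apply: derived_base; rewrite inE Af.
have dF e : e \in edges F -> e != e0 -> derived F (clique A :|: E) (psi @: e).
  move=> Fe ne; have [te|] := boolP (e \in touching F S).
    by apply: derived_base; apply/setUP; right; rewrite imset_f // in_setD1 ne.
  rewrite touchingE Fe negbK => eS; apply: dA; rewrite inE card_psi //.
  exact: subset_trans (imsetS _ eS) psiA.
have dF0 e : e \in edges F -> derived F (clique A :|: E) (psi @: e).
  by move=> Fe; have [->|ne] := eqVneq e e0; [apply: derived_copy | apply: dF].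
pose W := psi @: setT.
have dW f : f \in clique W -> derived F (clique A :|: E) f.
  exact: derived_in_copy.
have BW : B \subset W.
  have -> : B = psi @: S by apply/esym/eqP; rewrite eqEcard psiS card_imset // cardS leqnn.
  by rewrite imsetS ?subsetT.
have cardW : #|V| <= #|W| by rewrite card_imset // cardsT.
(* The image of [~: S] lies in both [A] and [W] and has [#|V| - #|B|] elements. *)
have leAW : beta F <= #|A :&: W|.
  apply: (@leq_trans #|psi @: (~: S)|).
    rewrite card_imset // -(leq_add2l #|S|) cardsC cardS.
    rewrite addnC -leq_subRL //.
    by have := leq_ltn_trans (leq0n _) (leq_trans B0 leB); rewrite subn_gt0 => /ltnW.
  by apply: subset_leq_card; rewrite subsetI psiA imsetS ?subsetT.
have BnA z : z \in B -> z \notin A by move=> Bz; rewrite (disjointFl dAB).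
move=> f /setIdP[/cards2P[u [w [nuw ->]]]].
have cross a b' : a \in A -> b' \in B -> derived F (clique A :|: E) [set a; b'].
  move=> Aa Bb; have Wb := subsetP BW _ Bb.
  have nab : a != b' by apply: contraTneq Aa => ->; apply: BnA.
  have [Wa|Wa] := boolP (a \in W).
    by apply: dW; rewrite inE cards2 nab subUset !sub1set Wa Wb.
  apply: (@derived_cross V T F A W) => //; first by exists e0.
  - by rewrite inE Wa.
  - by rewrite inE Wb BnA.
rewrite subUset !sub1set => /andP[/setUP[Au|Bu] /setUP[Aw|Bw]].
- by apply: dA; rewrite inE cards2 nuw subUset !sub1set Au Aw.
- exact: cross.
- by rewrite (setUC [set u]); apply: cross.
- by apply: dW; rewrite inE cards2 nuw subUset !sub1set !(subsetP BW).
Qed.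

Lemma subset_of_card (T : finType) (A : {set T}) k :
  k <= #|A| -> exists2 B : {set T}, B \subset A & #|B| = k.
Proof.
move=> le_k.
have : 0 < #|[set B : {set T} | B \subset A & #|B| == k]|.
  by rewrite cards_draws bin_gt0.
by case/card_gt0P=> B; rewrite inE => /andP[sBA /eqP cardB]; exists B.
Qed.

(** Induction on the decomposition. The base is a copy of [F] minus an edge on [#|V|] vertices; each
    part [k] splits off [k] vertices [B], which [extend_clique] joins to the clique on the rest. *)
Lemma generating_set (V T : finType) (F : sgraph V) (t : seq nat) (A : {set T}) :
  (exists e : {set V}, e \in edges F) ->
  (forall x : V, exists2 e : {set V}, e \in edges F & x \in e) ->
  (forall g, g \in clique setT -> derived F (edges F) g) ->
  all (fun k => 0 < k <= #|V| - beta F) t -> #|A| = #|V| + \sum_(k <- t) k ->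
  exists E : {set {set T}},
    [/\ E \subset clique setT, #|E| <= #|edges F| - 1 + \sum_(k <- t) e_ F k &
        forall f, f \in clique A -> derived F E f].
Proof.
move=> [e0 Fe0] no_iso Fsat.
elim: t A => [|k t IHt] A /=.
  rewrite !big_nil !addn0 => _ cardA.
  have [z Az] : exists z, z \in A.
    by apply/card_gt0P; rewrite cardA; apply: leq_trans (beta_edge_bound Fe0); rewrite addn2.
  have [|||psi [inj_psi _ psiA]] := @embed_split V T z set0 A set0.
  - by rewrite -setI_eq0 setI0.
  - by rewrite !cards0.
  - by rewrite cardA max_card.
  rewrite setC0 in psiA.
  have psiE : psi @: setT = A.
    by apply/eqP; rewrite eqEcard psiA card_imset // cardsT cardA leqnn.
  exists [set psi @: (e : {set V}) | e in edges F :\ e0]; split.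
  - apply/subsetP => _ /imsetP[e /setD1P[_ Fe] ->].
    by rewrite inE subsetT card_imset // (edge_card Fe).
  - by apply: leq_trans (leq_imset_card _ _) _; rewrite (cardsD1 e0 (edges F)) Fe0 addKn.
  rewrite -psiE => f; apply: derived_in_copy => // e Fe.
  have base e' : e' \in edges F -> e' != e0 ->
      derived F [set psi @: (e : {set V}) | e in edges F :\ e0] (psi @: e').
    by move=> Fe' ne; apply: derived_base; rewrite imset_f // in_setD1 ne.
  by have [->|ne] := eqVneq e e0; [apply: derived_copy | apply: base].
rewrite !big_cons => /andP[k_bnd /IHt{}IHt] cardA.
have [|B sBA cardB] := @subset_of_card _ A k.
  by rewrite cardA addnCA leq_addr.
have cardAB : #|A :\: B| = #|V| + \sum_(j <- t) j.
  by rewrite cardsD (setIidPr sBA) cardA cardB addnCA addKn.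
have [E0 [sE0 cardE0 dE0]] := IHt _ cardAB.
have [|||E1 [sE1 cardE1 dE1]] := extend_clique (A := A :\: B) (B := B) no_iso Fsat.
- by rewrite cardAB leq_addr.
- by rewrite disjoint_sym disjoints_subset setDE setCI setCK subsetUr.
- by rewrite cardB.
exists (E0 :|: E1); split.
- by rewrite subUset sE0.
- apply: leq_trans (leq_card_setU _ _) _.
  by rewrite addnCA addnC leq_add // -cardB.
move=> f; rewrite -{1}(setID A B) setUC (setIidPr sBA) => /dE1.
apply: derived_trans => g /setUP[/dE0|E1g].
  by apply: derived_trans => h Eh; apply: derived_base; rewrite inE Eh.
by apply: derived_base; rewrite inE E1g orbT.
Qed.

(** * Exploring a percolation process: lower bounds *)

Definition edges_in (T : finType) (H : sgraph T) (U : {set T}) :=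
  [set f in edges H | f \subset U].

(** If some pair is outside [edges H :|: clique U], the first derived edge outside it belongs to a
    copy that leaves [U]. If there is no such pair, any injection hitting a vertex outside [U]
    serves. *)
Lemma almost_copy_leaving (V T : finType) (F : sgraph V) (H : sgraph T)
    (U : {set T}) :
  (exists e, e \in edges F) -> #|V| <= #|T| -> weakly_saturated F H ->
  U != setT ->
  exists phi e0, almost_copy F (edges H :|: clique U) phi e0 /\
    ~~ (phi @: setT \subset U).
Proof.
move=> [e Fe] leVT /weakly_saturatedP wsH nU.
have [allP|/subsetPn[f Tf nPf]] := boolP (clique setT \subset edges H :|: clique U).
  have [z Uz] : exists z, z \notin U.
    apply/existsP; rewrite -negb_forall; apply: contra nU => /forallP UT.
    by apply/eqP/setP => z; rewrite inE; move: (UT z).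
  have /card_gt0P[x ex] : 0 < #|e| by rewrite (edge_card Fe).
  have [|||g [gE inj_g _]] := @extend_inj_room V T (fun=> z) [set x] (~: [set x]) setT.
  - by move=> u w /set1P-> /set1P->.
  - by rewrite disjoints_subset setCK.
  - by rewrite cardsT.
  have {}inj_g : injective g by move=> u w; apply: inj_g; rewrite setUCr inE.
  exists g, e; split.
    split=> // e' Fe' _; apply: (subsetP allP).
    by rewrite inE subsetT card_imset // (edge_card Fe').
  by apply/subsetPn; exists z => //; rewrite -(gE x) ?set11 ?imset_f.
have [phi [e0 [cpy nPe0]]] := derived_escape (subsetUl _ _) (wsH f Tf) nPf.
exists phi, e0; split=> //; case: cpy => inj_phi Fe0 _.
apply: contra nPe0 => sWU; apply/setUP; right.
by rewrite inE card_imset // (edge_card Fe0) (subset_trans (imsetS _ (subsetT _)) sWU).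
Qed.

(** An edge of the copy with an end outside [U] is not in [clique U], so it belongs to [H] unless it
    is the image of [e0]. That single exception is covered by the subtracted 1 in [e_]. *)
Lemma new_edges (V T : finType) (F : sgraph V) (H : sgraph T) (U : {set T}) phi e0 :
  almost_copy F (edges H :|: clique U) phi e0 ->
  e_ F #|phi @: setT :\: U| <= #|edges_in H (phi @: setT) :\: edges_in H U|.
Proof.
case=> inj_phi Fe0 cpy.
pose S := phi @^-1: (~: U).
have -> : #|phi @: setT :\: U| = #|S|.
  rewrite -(card_imset _ inj_phi); apply: eq_card => z.
  apply/setDP/imsetP => [[/imsetP[x _ ->] Ux]|[x Sx ->]].
    by exists x; rewrite // !inE.
  by rewrite imset_f //; move: Sx; rewrite !inE.
apply: leq_trans (e_le F S) _.
apply: (@leq_trans #|touching F S :\ e0|).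
  by rewrite (cardsD1 e0 (touching F S)); case: (e0 \in _); rewrite ?add1n ?leq_pred.
rewrite -(card_imset _ (imset_inj inj_phi)); apply: subset_leq_card.
apply/subsetP => _ /imsetP[e /setD1P[ne te] ->].
move: te; rewrite touchingE => /andP[Fe /subsetPn[x ex]].
rewrite !inE negbK => Ux.
have nU : ~~ (phi @: e \subset U).
  by apply/subsetPn; exists (phi x); rewrite ?imset_f.
rewrite (negbTE nU) andbF /= imsetS ?subsetT // andbT.
by have := cpy e Fe ne; rewrite !inE (negbTE nU) andbF orbF.
Qed.

Lemma edges_in_growth (V T : finType) (F : sgraph V) (H : sgraph T) (U : {set T})
    phi e0 :
  almost_copy F (edges H :|: clique U) phi e0 ->
  #|edges_in H U| + e_ F #|phi @: setT :\: U| <=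
    #|edges_in H (U :|: phi @: setT)|.
Proof.
move=> /new_edges; set W := phi @: setT; rewrite -(leq_add2l #|edges_in H U|).
move=> /leq_trans; apply.
have : [disjoint edges_in H U & edges_in H W :\: edges_in H U].
  by rewrite disjoint_sym disjoints_subset setDE subsetIr.
rewrite -leq_card_setU => /eqP <-; apply: subset_leq_card.
apply/subsetP => f /setUP[|/setDP[]]; rewrite !inE => /andP[-> sf].
  by rewrite subsetU ?sf.
by rewrite subsetU ?sf ?orbT.
Qed.

Lemma cardC_setU (T : finType) (U W : {set T}) :
  #|~: U| = #|W :\: U| + #|~: (U :|: W)|.
Proof. by rewrite -(cardsID W (~: U)) setIC -setDE setCU [_ :\: W]setDE. Qed.

(** As long as [U] is not everything, a copy leaving [U] is adjoined to it; the parts of [t] are the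
    numbers of vertices gained at each stage. *)
Lemma weakly_saturated_lower_bound (V T : finType) (F : sgraph V) (H : sgraph T)
    (U : {set T}) :
  (exists e, e \in edges F) -> #|V| <= #|T| -> weakly_saturated F H ->
  exists t : seq nat,
    [/\ all (fun k => 0 < k) t, \sum_(k <- t) k = #|~: U| &
        #|edges_in H U| + \sum_(k <- t) e_ F k <= #|edges H|].
Proof.
move=> Fe leVT wsH.
have [n] := ubnP #|~: U|; elim: n U => // n IHn U leU.
have [->|nU] := eqVneq U setT.
  exists [::]; rewrite !big_nil setCT cards0 addn0; split=> //.
  by apply: subset_leq_card; apply/subsetP => f /setIdP[].
have [phi [e0 [cpy nsub]]] := almost_copy_leaving Fe leVT wsH nU.
set W := phi @: setT in nsub.
have WU0 : 0 < #|W :\: U| by rewrite card_gt0 setD_eq0.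
have cardU := cardC_setU U W.
have [|t [t0 tE tle]] := IHn (U :|: W).
  by rewrite -ltnS (leq_trans _ leU) // ltnS cardU -add1n leq_add2r.
exists (#|W :\: U| :: t); rewrite !big_cons /= WU0 tE cardU; split=> //.
by apply: leq_trans tle; rewrite addnA leq_add2r (edges_in_growth cpy).
Qed.

Lemma e_card (V : finType) (F : sgraph V) : e_ F #|V| = #|edges F| - 1.
Proof.
have [S cardS ->] := e_attained F (leqnn #|V|).
have -> : S = setT by apply/eqP; rewrite eqEcard subsetT cardsT cardS leqnn.
rewrite -subn1; congr (#|pred_of_set _| - 1); apply/setP => e; rewrite touchingE setCT subset0.
case Fe: (e \in edges F) => //=.
by rewrite -cards_eq0 (edge_card Fe).
Qed.

Lemma first_copy (V T : finType) (F : sgraph V) (H : sgraph T) :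
  (exists e, e \in edges F) -> #|V| <= #|T| -> weakly_saturated F H ->
  exists phi e0, almost_copy F (edges H) phi e0 /\
    #|edges F| - 1 <= #|edges_in H (phi @: setT)|.
Proof.
move=> Fe leVT wsH.
have V0 : 0 < #|V|.
  by case: Fe => e /beta_edge_bound; rewrite addn2; apply: leq_trans.
(* Exploration starts from the empty set: [clique set0] is empty, so the copy has all its edges but
   one in [H] itself. *)
have n0 : set0 != setT :> {set T}.
  by rewrite eq_sym -cards_eq0 cardsT -lt0n (leq_trans V0).
have [phi [e0 [cpy _]]] := almost_copy_leaving Fe leVT wsH n0.
exists phi, e0; split; last first.
  apply: leq_trans (subset_leq_card (subsetDl _ (edges_in H set0))).
  by have := new_edges cpy; rewrite setD0 card_imset ?cardsT ?e_card //; case: cpy.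
case: cpy => inj_phi Fe0 cpy; split=> // e' Fe' ne.
have := cpy e' Fe' ne; rewrite !inE => /orP[//|/andP[/eqP c]].
by rewrite subset0 -cards_eq0 c.
Qed.

Lemma wsat_card_lower (V : finType) (F : sgraph V) :
  (exists e, e \in edges F) -> #|edges F| - 1 <= wsat #|V| F.
Proof.
move=> Fe; have [H [wsH ->]] := wsat_attained F #|V|.
have [|phi [e0 [_ le]]] := first_copy Fe _ wsH; first by rewrite card_ord.
by apply: leq_trans le _; apply: subset_leq_card; apply/subsetP => f /setIdP[].
Qed.

(** An optimal graph on [#|V|] vertices contains a copy of [F] minus an edge and has just as many
    edges, so it is that copy. The map [phi] is then a bijection, and its inverse carries the
    percolation back to [V]. *)
Lemma self_saturated (V : finType) (F : sgraph V) :
  (exists e, e \in edges F) -> wsat #|V| F = #|edges F| - 1 ->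
  forall g, g \in clique setT -> derived F (edges F) g.
Proof.
move=> Fe wsatE; have [H [wsH HE]] := wsat_attained F #|V|.
have [|phi [e0 [[inj_phi Fe0 cpy] _]]] := first_copy Fe _ wsH.
  by rewrite card_ord.
have [psi phiK psiK] : bijective phi by apply: inj_card_bij; rewrite ?card_ord.
have HF : edges H = [set phi @: (e : {set V}) | e in edges F :\ e0].
  apply/esym/eqP; rewrite eqEcard; apply/andP; split.
    by apply/subsetP => _ /imsetP[e /setD1P[ne Fe'] ->]; apply: cpy.
  rewrite -HE wsatE card_imset; last exact: imset_inj.
  by rewrite (cardsD1 e0 (edges F)) Fe0 addKn.
have psi_inj := can_inj psiK.
have imK (e : {set V}) : psi @: (phi @: e) = e.
  by rewrite -imset_comp (eq_imset (g := id)) ?imset_id // => z /=; rewrite phiK.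
move=> g /setIdP[g2 _].
have : derived F (edges H) (phi @: g).
  apply: (proj1 (weakly_saturatedP F H) wsH).
  by rewrite inE subsetT andbT card_imset.
move/(derived_imset psi_inj); rewrite imK; apply: derived_trans => f /imsetP[h].
rewrite HF => /imsetP[e /setD1P[_ Fe'] ->] ->; rewrite imK.
exact: derived_base.
Qed.

(** * Decompositions into elements of K_r *)

Lemma lt_sum_mem (t : seq nat) j :
  1 < size t -> all (fun k => 0 < k) t -> j \in t -> j < \sum_(k <- t) k.
Proof.
move=> size_t t0 tj; rewrite (big_rem j tj) /= -[ltnLHS]addn0 ltn_add2l.
have rem0 : all (fun k => 0 < k) (rem j t).
  by apply/allP => k /mem_rem; apply: (allP t0).
apply: leq_trans (size_le_sum rem0).
by rewrite size_rem // -ltnS prednK // ltnW.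
Qed.

Lemma bounded_maximum (P : nat -> Prop) N k :
  P k -> (forall i, P i -> i <= N) -> exists m, is_maximum P m.
Proof.
move=> Pk; elim: N => [|N IHN] bnd.
  by exists k; split=> // i /bnd; rewrite leqn0 => /eqP->.
have [PN|nPN] := classic (P N.+1); first by exists N.+1.
apply: IHN => i Pi; have := bnd i Pi; rewrite leq_eqVlt => /orP[/eqP iN|//].
by rewrite iN in Pi.
Qed.

(** The set is nonempty: 1 is not a sum of two or more positive integers, so it always belongs to
    it. *)
Lemma inKr_maximum (V : finType) (F : sgraph V) r :
  r < #|V| -> exists m, is_maximum (inKr F r) m.
Proof.
move=> r_lt; apply: (@bounded_maximum _ #|V| 1); last first.
  by move=> i [[/andP[]]].
split; last by rewrite subn_gt0.
split; first by rewrite (leq_trans _ r_lt).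
case=> t [size_t t0 sum_t _].
by have := leq_trans size_t (size_le_sum t0); rewrite sum_t.
Qed.

Lemma refine_parts (V : finType) (F : sgraph V) (P : nat -> Prop) (t : seq nat) :
  (forall k, k \in t -> exists u : seq nat,
    [/\ (forall j, j \in u -> P j), \sum_(j <- u) j = k &
        \sum_(j <- u) e_ F j <= e_ F k]) ->
  exists u : seq nat,
    [/\ (forall j, j \in u -> P j), \sum_(j <- u) j = \sum_(k <- t) k &
        \sum_(j <- u) e_ F j <= \sum_(k <- t) e_ F k].
Proof.
elim: t => [_|k t IHt tP]; first by exists [::]; rewrite !big_nil.
have [u1 [Pu1 sum1 le1]] := tP k (mem_head _ _).
have [|u2 [Pu2 sum2 le2]] := IHt.
  by move=> j tj; apply: tP; rewrite inE tj orbT.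
exists (u1 ++ u2); rewrite !big_cat !big_cons /= sum1 sum2; split=> //.
  by move=> j; rewrite mem_cat => /orP[/Pu1|/Pu2].
exact: leq_add.
Qed.

(** If [k] is not in K, it splits at no extra cost into strictly smaller parts, which still respect
    the bound [#|V| - r]; strong induction applies to them. *)
Lemma refine_inKr (V : finType) (F : sgraph V) r k :
  0 < k <= #|V| - r -> exists u : seq nat,
    [/\ (forall j, j \in u -> inKr F r j), \sum_(j <- u) j = k &
        \sum_(j <- u) e_ F j <= e_ F k].
Proof.
elim/ltn_ind: k => k IHk k_bnd; have /andP[k0 le_k] := k_bnd.
have [inKk|ninK] := classic (inK F k).
  exists [:: k]; rewrite !big_seq1; split=> // j; rewrite inE => /eqP->.
  by split.
have [t [size_t t0 sum_t le_t]] : exists t : seq nat,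
    [/\ 2 <= size t, all (fun k => 0 < k) t, \sum_(k <- t) k = k
      & \sum_(k <- t) e_ F k <= e_ F k].
  apply: NNPP => nt; apply: ninK; split=> //.
  by rewrite k0 (leq_trans le_k) ?leq_subr.
have [|u [Pu sum_u le_u]] := @refine_parts V F (inKr F r) t.
  move=> j tj; have lt_j : j < k by rewrite -sum_t lt_sum_mem.
  by apply: IHk; rewrite ?(allP t0 j tj) // (leq_trans (ltnW lt_j)).
by exists u; rewrite sum_u sum_t; split=> //; apply: leq_trans le_t.
Qed.

(** * Bounding the elements of K by means of beta *)

(** Once the vertices of [F] mapped into both sets are deleted, the edge [e0] alone joins those
    mapped into [W1] to those mapped into [W2], so it is a cut edge. *)
Lemma beta_le_meet (V T : finType) (F : sgraph V) (W1 W2 : {set T}) phi e0 :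
  almost_copy F (clique W1 :|: clique W2) phi e0 ->
  phi @: e0 \notin clique W1 :|: clique W2 -> W1 :|: W2 = setT ->
  beta F <= #|W1 :&: W2|.
Proof.
move=> [inj_phi Fe0 cpy]; rewrite !inE card_imset // (edge_card Fe0) eqxx /=.
rewrite negb_or => /andP[/subsetPn[_ /imsetP[u e0u ->] W1u]].
move=> /subsetPn[_ /imsetP[w e0w ->] W2w] W12.
have W2u : phi u \in W2.
  by have := in_setT (phi u); rewrite -W12 inE (negbTE W1u).
have W1w : phi w \in W1.
  by have := in_setT (phi w); rewrite -W12 inE (negbTE W2w) orbF.
have nuw : w != u by apply: contraNneq W1u => <-.
have e0E : e0 = [set w; u].
  apply/esym/eqP; rewrite eqEcard subUset !sub1set e0u e0w cards2 nuw.
  by rewrite (edge_card Fe0).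
pose D := phi @^-1: (W1 :&: W2).
have cardD : #|D| <= #|W1 :&: W2|.
  rewrite -(card_imset _ inj_phi); apply: subset_leq_card.
  by apply/subsetP => _ /imsetP[z + ->]; rewrite inE.
apply: leq_trans cardD; apply: (@beta_le _ _ _ (phi @^-1: W1) e0).
- rewrite inE Fe0 e0E subUset !sub1set !inE.
  by rewrite (negbTE W1u) (negbTE W2w) andbF.
- by rewrite e0E; apply: crosses_pair; rewrite inE.
move=> e /setIdP[Fe eD] ne; rewrite /crosses negb_and !negbK.
case/setUP: (cpy e Fe ne); rewrite inE => /andP[_ /subsetP sub].
  by apply/orP; left; apply/subsetP => z ez; rewrite inE sub ?imset_f.
apply/orP; right; apply/subsetP => z ez; have := subsetP eD z ez.
by rewrite !inE (sub (phi z)) ?imset_f // andbT.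
Qed.

Lemma inK_le_beta (V : finType) (F : sgraph V) m :
  (exists e, e \in edges F) -> inK F m ->
  wsat (#|V| + m) F <= e_ F m + #|edges F| - 1 -> m <= #|V| - beta F.
Proof.
move=> Fe [/andP[m0 le_m] irred].
have l0 : 0 < #|edges F| by case: Fe => e Fe; apply/card_gt0P; exists e.
have [H [wsH ->]] := wsat_attained F (#|V| + m).
rewrite -addnBA // (addnC (e_ F m)) => leH.
have leVT : #|V| <= #|'I_(#|V| + m)| by rewrite card_ord leq_addr.
have [phi1 [e1 [[inj1 Fe1 cpy1] le1]]] := first_copy Fe leVT wsH.
set W1 := phi1 @: setT in le1.
have card1 : #|W1| = #|V| by rewrite card_imset // cardsT.
have nW1 : W1 != setT.
  apply: contraTneq m0 => W1T; rewrite -leqNgt -(leq_add2l #|V|) addn0 -{2}card1.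
  by rewrite W1T cardsT card_ord.
have [phi2 [e2 [cpy2 nsub]]] := almost_copy_leaving Fe leVT wsH nW1.
have le2 := edges_in_growth cpy2; have le2' := new_edges cpy2.
set W2 := phi2 @: setT in nsub le2 le2'.
have card2 : #|W2| = #|V| by rewrite card_imset ?cardsT //; case: cpy2.
have W21 : 0 < #|W2 :\: W1| by rewrite card_gt0 setD_eq0.
have [t [t0 tE tle]] := weakly_saturated_lower_bound (W1 :|: W2) Fe leVT wsH.
have mE : m = #|W2 :\: W1| + \sum_(k <- t) k.
  by rewrite tE -cardC_setU cardsCs setCK card_ord card1 addKn.
(* A nonempty [t], preceded by [#|W2 :\: W1|], would split [m] into at least two parts of total cost
   at most [e_ F m], contradicting [irred]. *)
case: t => [|k t] in t0 tE tle mE; last first.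
  case: irred; exists [:: #|W2 :\: W1|, k & t]; split=> //.
  - by rewrite /= W21.
  - by rewrite big_cons.
  rewrite big_cons -(leq_add2l (#|edges F| - 1)) (leq_trans _ leH) //.
  by rewrite (leq_trans _ tle) // addnA leq_add2r (leq_trans _ le2) // leq_add2r.
rewrite big_nil addn0 in mE; rewrite -mE in le2'.
(* The two copies already account for [#|edges F| - 1 + e_ F m] edges, the upper bound for [H], so
   [H] has no others. *)
have HW : edges H \subset clique W1 :|: clique W2.
  have sub : edges_in H W1 :|: (edges_in H W2 :\: edges_in H W1) \subset edges H.
    by apply/subsetP => f /setUP[/setIdP[]|/setDP[/setIdP[]]].
  have -> : edges H = edges_in H W1 :|: (edges_in H W2 :\: edges_in H W1).
    apply/esym/eqP; rewrite eqEcard sub (leq_trans leH) //.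
    have : [disjoint edges_in H W1 & edges_in H W2 :\: edges_in H W1].
      by rewrite disjoint_sym disjoints_subset setDE subsetIr.
    by rewrite -leq_card_setU => /eqP->; apply: leq_add.
  apply/subsetP => f /setUP[/setIdP[/edge_card f2 sf]|/setDP[/setIdP[/edge_card f2 sf]] _].
    by rewrite !inE f2 sf.
  by rewrite !inE f2 sf orbT.
have W12 : W1 :|: W2 = setT.
  by apply/setC_inj/eqP; rewrite setCT -cards_eq0 -tE big_nil.
have meet : #|W1 :&: W2| = #|V| - m.
  rewrite [X in _ - X]mE cardsD setIC card2 subKn //.
  by rewrite -[leqRHS]card2 subset_leq_card ?subsetIl.
have [b] := card_gt0P W21; case/setDP=> W2b W1b.
have /card_gt0P[a /setDP[W1a W2a]] : 0 < #|W1 :\: W2|.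
  by rewrite cardsD meet card1 subKn.
have nab : a != b by apply: contraNneq W1b => <-.
(* The pair [[set a; b]] lies in neither clique, so its derivation has to leave their union. *)
have [||phi3 [e3 [cpy3 nP3]]] := derived_escape HW (f := [set a; b]) (F := F).
- apply: (proj1 (weakly_saturatedP F H) wsH).
  by rewrite inE subsetT cards2 nab.
- by rewrite !inE !subUset !sub1set (negbTE W1b) (negbTE W2a) !andbF.
have := beta_le_meet cpy3 nP3 W12; rewrite meet => le_beta.
by rewrite leq_subRL ?(leq_trans le_beta) ?leq_subr // addnC -leq_subRL.
Qed.

Theorem theorem5p4 (V : finType) (F : sgraph V) (r : nat)
  (F_edge : exists e : {set V}, e \in edges F)
  (F_no_isolated : forall x : V, exists2 e : {set V}, e \in edges F & x \in e)
  (r_lt_v : r < #|V|) :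
  let v := #|V| in
  let l := #|edges F| in
  let P1 := forall n : nat, v <= n -> wsat n F <= gstar F r (n - v) + l - 1 in
  let P2 := wsat v F = l - 1 /\
    exists2 m : nat, is_maximum (inKr F r) m & m <= v - beta F in
  let P3 := wsat v F = l - 1 /\
    forall i : nat, gstar F (beta F) i <= gstar F r i in
  (P1 <-> P2) /\ (P2 <-> P3).
Proof.
move=> v l P1 P2 P3.
have l0 : 0 < l by case: F_edge => e Fe; apply/card_gt0P; exists e.
have beta_lt : beta F < v.
  by case: F_edge => e /beta_edge_bound; rewrite addn2; apply: ltnW.
have P12 : P1 -> P2.
  move=> leP; split.
    apply/eqP; rewrite eqn_leq wsat_card_lower // andbT.
    by have := leP v (leqnn v); rewrite subnn /gstar eqxx.
  have [m maxm] := inKr_maximum F r_lt_v.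
  exists m => //; case: (maxm.1) => Km m_bnd; apply: inK_le_beta => //.
  apply: leq_trans (leP _ (leq_addr m v)) _.
  rewrite addKn leq_sub2r // leq_add2r.
  (* The decomposition with the single part [m] is admissible, since [m] is at most [#|V| - r]. *)
  have := @gstar_le V F r [:: m]; rewrite !big_seq1; apply.
  by rewrite /= m_bnd.
have P23 : P2 -> P3.
  move=> [wsatE [m maxm le_m]]; split=> // i.
  have [t [t_bnd <- ->]] := gstar_attained F i r_lt_v.
  have [|u [Ku <- le_u]] := @refine_parts V F (inKr F r) t.
    by move=> k /(allP t_bnd); apply: refine_inKr.
  (* Elements of K_r are at most [m], hence at most [v - beta F]: the refined decomposition is
     admissible for [beta F]. *)
  apply: leq_trans le_u; apply: gstar_le; apply/allP => j /Ku Kj.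
  by case: (Kj) => _ /andP[-> _]; apply: leq_trans le_m; apply: maxm.2.
have P31 : P3 -> P1.
  move=> [wsatE le_g] n le_n.
  (* The decomposition is taken optimal for [beta F] rather than [r], so that its parts meet the
     bound required by [generating_set]. *)
  have [t [t_bnd sum_t gE]] := gstar_attained F (n - v) beta_lt.
  have cardT : #|[set: 'I_n]| = #|V| + \sum_(k <- t) k.
    by rewrite sum_t cardsT card_ord subnKC.
  have [E [sE cardE dE]] := generating_set F_edge F_no_isolated
    (self_saturated F_edge wsatE) t_bnd cardT.
  have [H HE] := graph_of_clique sE.
  apply: (@leq_trans #|edges H|).
    by apply/wsat_le/weakly_saturatedP; rewrite HE.
  rewrite HE -addnBA // addnC (leq_trans cardE) // leq_add2l -gE.
  exact: le_g.
by split; [split=> [/P12|/P23/P31] | split=> [/P23|/P31/P12]].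
Qed.
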